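(* Let $(X,\mathcal F,m)$ be a $\sigma$-finite measure space, $\mathbb{K}\in\{\mathbb{R},\mathbb{C}\}$ and $n\in\mathbb{N}$, $n\ge 1$. Let $T:L^2(X;\mathbb{K}^n)\to L^\infty(X;\mathbb{K}^n)$ be a bounded linear operator and let $V:X\to\mathbb{K}^{n\times n}$ be measurable with $V(x)$ hermitian (symmetric if $\mathbb{K}=\mathbb{R}$) for every $x\in X$ and $\|V\|_{2,\mathrm{HS}}<\infty$. Then the operator $VT$, $(VTf)(x)=V(x)\,(Tf)(x)$, is a bounded operator on $L^2(X;\mathbb{K}^n)$ which is Hilbert--Schmidt, and $$ \|VT\|_{\mathrm{HS}} \leq \sqrt{n}\; \|V\|_{2,\mathrm{HS}}\; \|T\|_{2,\infty}.$$
   Context: The space $\mathbb{K}^n$ carries the Euclidean norm $|\cdot|$; $\|f\|_2^2=\int_X|f(x)|^2\,dm(x)$ and $\|f\|_\infty=\operatorname{ess\,sup}_{x}|f(x)|$ for $\mathbb{K}^n$-valued $f$. $\|T\|_{2,\infty}$ denotes the operator norm of $T$ from $L^2(X;\mathbb{K}^n)$ to $L^\infty(X;\mathbb{K}^n)$. For a measurable matrix function $V=(V_{ij})$, $$\|V\|_{2,\mathrm{HS}}^2:=\int_X\|V(x)\|_{\mathrm{HS}}^2\,dm(x)=\sum_{i,j=1}^n\|V_{ij}\|_2^2,$$ where $\|V(x)\|_{\mathrm{HS}}$ is the Hilbert--Schmidt (Frobenius) norm of the matrix. If this is finite, $V$ acts as a bounded multiplication operator from $L^\infty(X;\mathbb{K}^n)$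 to $L^2(X;\mathbb{K}^n)$. $\|VT\|_{\mathrm{HS}}$ is the Hilbert--Schmidt norm on $L^2(X;\mathbb{K}^n)$. *)

(* Defs.v *)
From HB Require Import structures.
From mathcomp Require Import all_boot all_order all_algebra.
From mathcomp Require Import complex.
From mathcomp Require Import all_classical all_reals all_analysis.

Set Implicit Arguments.
Unset Strict Implicit.
Unset Printing Implicit Defensive.

Import Order.TTheory GRing.Theory Num.Theory.
Import numFieldNormedType.Exports.

Local Open Scope classical_set_scope.
Local Open Scope ring_scope.

Variant scalar_kind := real_scalars | complex_scalars.

Definition scalar_field (R : realType) (k : scalar_kind) : numFieldType :=
  match k with real_scalars => R | complex_scalars => R[i] end.
Arguments scalar_field R k : clear implicits.

Definition scalar_re (R : realType) (k : scalar_kind) : scalar_field R k -> R :=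
  match k with real_scalars => id | complex_scalars => @complex.Re R end.

Definition scalar_im (R : realType) (k : scalar_kind) : scalar_field R k -> R :=
  match k with real_scalars => fun=> 0 | complex_scalars => @complex.Im R end.

Definition scalar_conj (R : realType) (k : scalar_kind) :
    scalar_field R k -> scalar_field R k :=
  match k with real_scalars => id | complex_scalars => @conjc R end.

(* The norm `|z| of a numFieldType lives in the field itself; for z : R[i] it
   is a complex number with zero imaginary part, so its real part is |z|. *)
Definition scalar_abs (R : realType) (k : scalar_kind) (z : scalar_field R k) : R :=
  scalar_re `|z|.

(* Hilbert-Schmidt (Frobenius) norm; on a column vector this is the Euclidean
   norm of K^n. *)
Definition mx_hsnorm (R : realType) (k : scalar_kind) (p q : nat)
    (A : 'M[scalar_field R k]_(p, q)) : R :=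
  Num.sqrt (\sum_(i < p) \sum_(j < q) scalar_abs (A i j) ^+ 2).

(* For real scalars the conjugation is the identity, and this is symmetry. *)
Definition is_hermitian (R : realType) (k : scalar_kind) (n : nat)
    (A : 'M[scalar_field R k]_n) : Prop :=
  A \is hermitianmx n false (@scalar_conj R k).

Section Lp_spaces.
Context (d : measure_display) (X : measurableType d) (R : realType).
Context (m : {measure set X -> \bar R}) (k : scalar_kind).
Local Notation K := (scalar_field R k).

Definition measurable_mx (p q : nat) (F : X -> 'M[K]_(p, q)) : Prop :=
  forall i j, measurable_fun [set: X] (fun x => scalar_re (F x i j)) /\
              measurable_fun [set: X] (fun x => scalar_im (F x i j)).

Definition mx_Lnorm (r : \bar R) (p q : nat) (F : X -> 'M[K]_(p, q)) : \bar R :=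
  'N[m]_r[EFin \o (fun x => mx_hsnorm (F x))]%E.

Definition scalar_integral (h : X -> K) : K :=
  match k return (X -> scalar_field R k) -> scalar_field R k with
  | real_scalars => fun h => \int[m]_x h x
  | complex_scalars => fun h =>
      Complex (\int[m]_x complex.Re (h x)) (\int[m]_x complex.Im (h x))
  end h.

Context (n : nat).

(* Elements of L^r(X; K^n) are handled through measurable representatives, and
   operators are maps on functions that respect equality m-almost everywhere.
   What an operator does outside of its domain L^r is irrelevant. *)
Definition Lspace_mx (r : \bar R) : set (X -> 'cV[K]_n) :=
  [set f | measurable_mx f /\ (mx_Lnorm r f < +oo)%E].

Record bounded_operator (r s : \bar R)
    (T : (X -> 'cV[K]_n) -> (X -> 'cV[K]_n)) : Prop := BoundedOperator {
  bounded_operator_range : forall f, Lspace_mx r f -> Lspace_mx s (T f);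
  bounded_operator_ae : forall f g, Lspace_mx r f -> Lspace_mx r g ->
    (\forall x \ae m, f x = g x) -> \forall x \ae m, T f x = T g x;
  bounded_operator_linear : forall (a : K) f g,
    Lspace_mx r f -> Lspace_mx r g ->
    \forall x \ae m, T (fun y => a *: f y + g y) x = a *: T f x + T g x;
  bounded_operator_bound : exists C : R, forall f, Lspace_mx r f ->
    (mx_Lnorm s (T f) <= C%:E * mx_Lnorm r f)%E }.

Definition operator_norm (r s : \bar R)
    (T : (X -> 'cV[K]_n) -> (X -> 'cV[K]_n)) : \bar R :=
  ereal_sup [set mx_Lnorm s (T f) | f in
    [set f | Lspace_mx r f /\ (mx_Lnorm r f <= 1)%E]].

Definition L2_inner (f g : X -> 'cV[K]_n) : K :=
  scalar_integral (fun x => \sum_(i < n) scalar_conj (f x i 0) * g x i 0).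

(* Distinct members of E are orthogonal unit vectors, hence not equal almost
   everywhere: E contains at most one representative of each class. *)
Record orthonormal_basis (E : set (X -> 'cV[K]_n)) : Prop := OrthonormalBasis {
  orthonormal_basis_L2 : E `<=` Lspace_mx 2%:E;
  orthonormal_basis_unit : forall e, E e -> L2_inner e e = 1;
  orthonormal_basis_orthogonal : forall e e', E e -> E e' -> e <> e' ->
    L2_inner e e' = 0;
  orthonormal_basis_complete : forall f, Lspace_mx 2%:E f ->
    (forall e, E e -> L2_inner e f = 0) -> \forall x \ae m, f x = 0 }.

Definition hs_sum (A : (X -> 'cV[K]_n) -> (X -> 'cV[K]_n))
    (E : set (X -> 'cV[K]_n)) : \bar R :=
  (\esum_(e in E) mx_Lnorm 2%:E (A e) ^+ 2)%E.

Definition hilbert_schmidt (A : (X -> 'cV[K]_n) -> (X -> 'cV[K]_n)) : Prop :=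
  bounded_operator 2%:E 2%:E A /\
  exists2 E, orthonormal_basis E & (hs_sum A E < +oo)%E.

(* For a bounded operator the sum does not depend on the orthonormal basis; the
   supremum only avoids singling one out. *)
Definition hs_norm (A : (X -> 'cV[K]_n) -> (X -> 'cV[K]_n)) : \bar R :=
  ereal_sup [set sqrte (hs_sum A E) | E in orthonormal_basis].

End Lp_spaces.

(* Main.v *)
Require Import Defs.
From mathcomp Require Import all_boot all_order all_algebra.
From mathcomp Require Import complex.
From mathcomp Require Import all_classical all_reals all_analysis.
From mathcomp Require Import measurable_realfun ess_sup_inf ring lra.

(** Write t for the norm of T. The heart of the matter is a pointwise form of
    Bessel's inequality. If e_1, ..., e_N are orthonormal and c is a vector of
    scalars, then the sum of the c_j e_j has L^2 norm |c| (Pythagoras,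
    integral_lincomb_orthonormal), hence |sum_j c_j (T e_j)(x)| <= t |c| for
    almost every x. The exceptional null set depends on c; restricting c to
    rational coordinates gives a single null set outside of which the inequality
    holds for all rational c (ae_rat_test_le). At such a point x, for each row i,
    the vector of the scalars (T e_j)(x)_i defines a functional of norm at most
    t on rational test vectors, so the sum over j of |(T e_j)(x)_i|^2 is at most
    t^2 (sum_sqr_le_of_rat_test). Summation over the n rows gives
      sum_j |(T e_j)(x)|^2 <= n t^2
    almost everywhere (ae_sum_operator_sqr_le), which is where the factor
    sqrt n comes from. Since the Hilbert-Schmidt norm of V(x) dominates its
    operator norm, integration yields
      sum_j ||V T e_j||_2^2 <= n t^2 ||V||_{2,HS}^2
    (sum_mul_operator_sqr_le). The bound does not depend on N, so it passes to
    the unordered sum over any orthonormal system (hs_sum_mul_le), and neither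
    separability of L^2 nor independence of the Hilbert-Schmidt sum from the
    basis is needed.

    Being Hilbert-Schmidt also requires some orthonormal basis. A maximal
    orthonormal system exists by Zorn's lemma, and it is complete because a
    nonzero function orthogonal to it could be normalized and added
    (orthonormal_basis_exists); completeness of L^2 plays no role. *)

Import Order.TTheory GRing.Theory Num.Theory.
Import numFieldNormedType.Exports.

Local Open Scope classical_set_scope.
Local Open Scope ring_scope.

(** * Real and imaginary parts of scalars *)

Section Scalars.
Set Implicit Arguments.
Unset Strict Implicit.
Context (R : realType) (k : scalar_kind).
Local Notation K := (scalar_field R k).
Implicit Types (z w : K) (a b : R).

(** The scalar a + ib; over the reals the imaginary part is dropped. *)
Definition scalar_mk a b : K :=
  match k return scalar_field R k with
  | real_scalars => a
  | complex_scalars => Complex a b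
  end.

Lemma scalar_eq z w : scalar_re z = scalar_re w -> scalar_im z = scalar_im w ->
  z = w.
Proof.
by rewrite /scalar_re /scalar_im; case: k z w => //= -[a b] [c d] /= -> ->.
Qed.

Lemma scalar_re_mk a b : scalar_re (scalar_mk a b) = a.
Proof. by rewrite /scalar_re /scalar_mk; case: k. Qed.

Lemma scalar_im_mk0 a : scalar_im (scalar_mk a 0) = 0.
Proof. by rewrite /scalar_im /scalar_mk; case: k. Qed.

Lemma scalar_im_mk_sqr_le a b : scalar_im (scalar_mk a b) ^+ 2 <= b ^+ 2.
Proof. by rewrite /scalar_im /scalar_mk; case: k => //=; rewrite expr0n sqr_ge0. Qed.

Lemma scalar_im_mkM a b z : scalar_im (scalar_mk a b) * scalar_im z = b * scalar_im z.
Proof.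
by rewrite /scalar_im /scalar_mk; case: k z => //= z; rewrite !mulr0.
Qed.

Lemma scalar_re0 : scalar_re (0 : K) = 0.
Proof. by rewrite /scalar_re; case: k. Qed.

Lemma scalar_im0 : scalar_im (0 : K) = 0.
Proof. by rewrite /scalar_im; case: k. Qed.

Lemma scalar_reD z w : scalar_re (z + w) = scalar_re z + scalar_re w.
Proof. by rewrite /scalar_re; case: k z w => //= -[a b] [c e]. Qed.

Lemma scalar_imD z w : scalar_im (z + w) = scalar_im z + scalar_im w.
Proof.
by rewrite /scalar_im; case: k z w => //= [_ _|[a b] [c e]] //; rewrite addr0.
Qed.

Lemma scalar_reM z w :
  scalar_re (z * w) = scalar_re z * scalar_re w - scalar_im z * scalar_im w.
Proof.
rewrite /scalar_re /scalar_im; case: k z w => //= [z w|[a b] [c e]] //.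
by rewrite mulr0 subr0.
Qed.

Lemma scalar_imM z w :
  scalar_im (z * w) = scalar_re z * scalar_im w + scalar_im z * scalar_re w.
Proof.
rewrite /scalar_re /scalar_im; case: k z w => //= [z w|[a b] [c e]] //.
by rewrite mulr0 mul0r addr0.
Qed.

Lemma scalar_re_sum I (s : seq I) (F : I -> K) :
  scalar_re (\sum_(i <- s) F i) = \sum_(i <- s) scalar_re (F i).
Proof. exact: (big_morph _ scalar_reD scalar_re0). Qed.

Lemma scalar_im_sum I (s : seq I) (F : I -> K) :
  scalar_im (\sum_(i <- s) F i) = \sum_(i <- s) scalar_im (F i).
Proof. exact: (big_morph _ scalar_imD scalar_im0). Qed.

Lemma scalar_re_conj z : scalar_re (scalar_conj z) = scalar_re z.
Proof. by rewrite /scalar_re /scalar_conj; case: k z => //= -[]. Qed.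

Lemma scalar_im_conj z : scalar_im (scalar_conj z) = - scalar_im z.
Proof.
rewrite /scalar_im /scalar_conj; case: k z => //= [_|[]//].
by rewrite oppr0.
Qed.

Lemma scalar_conj0 : scalar_conj 0 = 0 :> K.
Proof.
by apply: scalar_eq; rewrite ?(scalar_re_conj, scalar_im_conj) // scalar_im0 oppr0.
Qed.

Lemma scalar_conjD z w : scalar_conj (z + w) = scalar_conj z + scalar_conj w.
Proof.
apply: scalar_eq; rewrite ?(scalar_reD, scalar_imD, scalar_re_conj, scalar_im_conj) //.
by rewrite opprD.
Qed.

Lemma scalar_conjM z w : scalar_conj (z * w) = scalar_conj z * scalar_conj w.
Proof.
apply: scalar_eq.
  by rewrite scalar_re_conj !scalar_reM !scalar_re_conj !scalar_im_conj mulrNN.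
rewrite scalar_im_conj !scalar_imM !scalar_re_conj !scalar_im_conj.
by rewrite mulrN mulNr opprD.
Qed.

Lemma scalar_conjK z : scalar_conj (scalar_conj z) = z.
Proof.
by apply: scalar_eq; rewrite ?scalar_re_conj // !scalar_im_conj opprK.
Qed.

Lemma scalar_conj_sum I (s : seq I) (F : I -> K) :
  scalar_conj (\sum_(i <- s) F i) = \sum_(i <- s) scalar_conj (F i).
Proof. exact: (big_morph _ scalar_conjD scalar_conj0). Qed.

Lemma scalar_abs_sqr z : scalar_abs z ^+ 2 = scalar_re z ^+ 2 + scalar_im z ^+ 2.
Proof.
rewrite /scalar_abs /scalar_re /scalar_im; case: k z => /= [z|z].
  by rewrite real_normK ?num_real // expr0n addr0.
by case: z => a b; rewrite /Num.norm /= sqr_sqrtr // addr_ge0 ?sqr_ge0.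
Qed.

Lemma scalar_abs_ge0 z : 0 <= scalar_abs z.
Proof.
rewrite /scalar_abs /scalar_re; case: k z => /= [z|z]; first exact: normr_ge0.
by case: z => a b; rewrite /Num.norm /= sqrtr_ge0.
Qed.

Lemma scalar_absM z w : scalar_abs (z * w) = scalar_abs z * scalar_abs w.
Proof.
apply/eqP; rewrite -(@eqrXn2 _ 2) ?mulr_ge0 ?scalar_abs_ge0 //; apply/eqP.
by rewrite exprMn !scalar_abs_sqr scalar_reM scalar_imM; ring.
Qed.

Lemma scalar_abs_sqrD z w :
  scalar_abs (z + w) ^+ 2 <= 2 * (scalar_abs z ^+ 2 + scalar_abs w ^+ 2).
Proof.
rewrite !scalar_abs_sqr scalar_reD scalar_imD.
have := sqr_ge0 (scalar_re z - scalar_re w).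
have := sqr_ge0 (scalar_im z - scalar_im w).
nra.
Qed.

Lemma scalar_mul_conj z : scalar_conj z * z = scalar_mk (scalar_abs z ^+ 2) 0.
Proof.
apply: scalar_eq; rewrite ?scalar_re_mk ?scalar_im_mk0 ?scalar_reM ?scalar_imM
  ?scalar_re_conj ?scalar_im_conj ?scalar_abs_sqr; ring.
Qed.

Lemma scalar_abs_mk_sqr_le a b : scalar_abs (scalar_mk a b) ^+ 2 <= a ^+ 2 + b ^+ 2.
Proof. by rewrite scalar_abs_sqr scalar_re_mk lerD2l scalar_im_mk_sqr_le. Qed.

Lemma scalar_abs_mk0_sqr a : scalar_abs (scalar_mk a 0) ^+ 2 = a ^+ 2.
Proof. by rewrite scalar_abs_sqr scalar_re_mk scalar_im_mk0 expr0n addr0. Qed.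

Lemma scalar_mk0M a b : scalar_mk a 0 * scalar_mk b 0 = scalar_mk (a * b) 0.
Proof.
by apply: scalar_eq; rewrite ?scalar_reM ?scalar_imM ?scalar_re_mk ?scalar_im_mk0; ring.
Qed.

Lemma scalar_mk10 : scalar_mk 1 0 = 1.
Proof. by rewrite /scalar_mk; case: k. Qed.

Lemma scalar_mk00 : scalar_mk 0 0 = 0.
Proof. by rewrite /scalar_mk; case: k. Qed.

Lemma scalar_mk0_sum I (s : seq I) (F : I -> R) :
  scalar_mk (\sum_(i <- s) F i) 0 = \sum_(i <- s) scalar_mk (F i) 0.
Proof.
apply: scalar_eq.
  by rewrite scalar_re_mk scalar_re_sum; apply: eq_bigr => i _; rewrite scalar_re_mk.
rewrite scalar_im_mk0 scalar_im_sum big1 // => i _; exact: scalar_im_mk0.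
Qed.

Lemma scalar_re_mkM a b z :
  scalar_re (scalar_mk a b * z) = a * scalar_re z - b * scalar_im z.
Proof. by rewrite scalar_reM scalar_re_mk scalar_im_mkM. Qed.

End Scalars.

(** * Finite families of reals *)

Section RealFamilies.
Set Implicit Arguments.
Unset Strict Implicit.
Context (R : realType).

Lemma sum_sqr_CauchySchwarz (I : finType) (a b : I -> R) :
  (\sum_i a i * b i) ^+ 2 <= (\sum_i a i ^+ 2) * (\sum_i b i ^+ 2).
Proof.
rewrite expr2 !big_distrlr /= -subr_ge0 -sumrB.
under eq_bigr => i _ do rewrite -sumrB.
set S := (X in 0 <= X).
have S2 : S + S = \sum_i \sum_j (a i * b j - a j * b i) ^+ 2.
  rewrite {2}/S exchange_big -big_split /=; apply: eq_bigr => i _.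
  rewrite -big_split /=; apply: eq_bigr => j _; ring.
have : 0 <= S + S.
  by rewrite S2; apply: sumr_ge0 => i _; apply: sumr_ge0 => j _; exact: sqr_ge0.
by move=> ?; lra.
Qed.

(** The approximation q of a satisfies |q| <= |a|, so that replacing the entries
    of a vector by such approximations does not increase its norm. *)
Lemma rat_approx_inward (a e : R) : 0 < e ->
  exists q : rat, (ratr q : R) ^+ 2 <= a ^+ 2 /\ a ^+ 2 - e <= ratr q * a.
Proof.
move=> e0; have [a0|a0|->] := ltgtP a 0; last first.
- by exists 0; rewrite rmorph0; split => //; nra.
- have [|q] := @rat_in_itvoo R (Num.max 0 (a - e / a)) a.
    by rewrite gt_max a0 /= ltrBlDr ltrDl divr_gt0.
  rewrite in_itv /= gt_max => /andP[/andP[q0 qe] qa].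
  exists q; split; first by nra.
  have -> : a ^+ 2 - e = (a - e / a) * a by field; rewrite gt_eqF.
  by rewrite ler_pM2r // ltW.
- have [|q] := @rat_in_itvoo R a (Num.min 0 (a - e / a)).
    by rewrite lt_min a0 /= ltrDl -mulrN -invrN divr_gt0 // oppr_gt0.
  rewrite in_itv /= lt_min => /andP[qa /andP[q0 qe]].
  exists q; split; first by nra.
  have -> : a ^+ 2 - e = (a - e / a) * a by field; rewrite lt_eqF.
  by rewrite ler_nM2r // ltW.
Qed.

(** By density, a linear form on R^I that is bounded by t on vectors with
    rational coordinates has norm at most t. *)
Lemma sum_sqr_le_of_rat_test (I : finType) (a : I -> R) (t : R) : 0 <= t ->
  (forall q : I -> rat, \sum_i ratr (q i) * a i <=
     t * Num.sqrt (\sum_i (ratr (q i)) ^+ 2)) ->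
  \sum_i a i ^+ 2 <= t ^+ 2.
Proof.
move=> t0 H; set s := \sum_i a i ^+ 2.
have s0 : 0 <= s by apply: sumr_ge0 => i _; exact: sqr_ge0.
have st : s <= t * Num.sqrt s.
  apply/ler_addgt0Pr => e e0.
  (* The #|I| approximation errors d sum up to at most e; the 1 keeps the
     denominator positive when I is empty. *)
  set d := e / (#|I|%:R + 1).
  have d0 : 0 < d by rewrite divr_gt0 // ltr_wpDl.
  have /(_ _)/cid-/all_sig[q qP] := fun i => @rat_approx_inward (a i) d d0.
  have q2 : Num.sqrt (\sum_i (ratr (q i) : R) ^+ 2) <= Num.sqrt s.
    by apply: ler_wsqrtr; apply: ler_sum => i _; have [] := qP i.
  have qa : s - e <= \sum_i ratr (q i) * a i.
    have h : \sum_i (a i ^+ 2 - d) <= \sum_i ratr (q i) * a i.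
      by apply: ler_sum => i _; have [] := qP i.
    apply: le_trans h; rewrite sumrB lerB // sumr_const -mulr_natr /d.
    by rewrite mulrAC ler_pdivrMr ?ltr_wpDl // ler_pM2l // lerDl.
  rewrite -lerBlDr (le_trans qa) // (le_trans (H q)) //.
  exact: ler_wpM2l.
have r0 := sqrtr_ge0 s.
have ss := sqr_sqrtr s0.
have [|tr] := leP (Num.sqrt s) t; first by move=> ?; rewrite -ss; nra.
by exfalso; nra.
Qed.

End RealFamilies.

(** * The Hilbert-Schmidt norm of a matrix *)

Section HSNorm.
Set Implicit Arguments.
Unset Strict Implicit.
Context (R : realType) (k : scalar_kind).
Local Notation K := (scalar_field R k).

Lemma scalar_absD (z w : K) : scalar_abs (z + w) <= scalar_abs z + scalar_abs w.
Proof.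
rewrite -ler_sqr ?nnegrE ?addr_ge0 ?scalar_abs_ge0 // sqrrD !scalar_abs_sqr.
rewrite scalar_reD scalar_imD.
have h : scalar_re z * scalar_re w + scalar_im z * scalar_im w <=
    scalar_abs z * scalar_abs w.
  apply: (le_trans (ler_norm _)).
  rewrite -ler_sqr ?nnegrE ?mulr_ge0 ?scalar_abs_ge0 //.
  rewrite real_normK ?num_real // exprMn !scalar_abs_sqr.
  have := sqr_ge0 (scalar_re z * scalar_im w - scalar_im z * scalar_re w).
  nra.
by nra.
Qed.

Lemma scalar_re_le_abs (z : K) : `|scalar_re z| <= scalar_abs z.
Proof.
rewrite -ler_sqr ?nnegrE ?scalar_abs_ge0 // real_normK ?num_real //.
by rewrite scalar_abs_sqr lerDl sqr_ge0.
Qed.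

Lemma scalar_im_le_abs (z : K) : `|scalar_im z| <= scalar_abs z.
Proof.
rewrite -ler_sqr ?nnegrE ?scalar_abs_ge0 // real_normK ?num_real //.
by rewrite scalar_abs_sqr lerDr sqr_ge0.
Qed.

Lemma scalar_abs_sum I (s : seq I) (F : I -> K) :
  scalar_abs (\sum_(i <- s) F i) <= \sum_(i <- s) scalar_abs (F i).
Proof.
elim/big_rec2: _ => [|i y x _ h].
  by rewrite -ler_sqr ?nnegrE ?scalar_abs_ge0 // scalar_abs_sqr scalar_re0 scalar_im0 expr0n addr0.
exact: le_trans (scalar_absD _ _) (lerD (lexx _) h).
Qed.

Section AnySize.
Context (p q : nat).
Implicit Types (A B : 'M[K]_(p, q)).

Lemma mx_hsnorm_ge0 A : 0 <= mx_hsnorm A.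
Proof. exact: sqrtr_ge0. Qed.

Lemma mx_hsnorm_sqr A :
  mx_hsnorm A ^+ 2 = \sum_(i < p) \sum_(j < q) scalar_abs (A i j) ^+ 2.
Proof.
rewrite sqr_sqrtr //; apply: sumr_ge0 => i _; apply: sumr_ge0 => j _.
exact: sqr_ge0.
Qed.

Lemma scalar_abs_sqr_le_mx_hsnorm A i j : scalar_abs (A i j) ^+ 2 <= mx_hsnorm A ^+ 2.
Proof.
rewrite mx_hsnorm_sqr (bigD1 i) //= (bigD1 j) //= -addrA lerDl.
rewrite addr_ge0 //; first by apply: sumr_ge0 => ? _; exact: sqr_ge0.
by apply: sumr_ge0 => ? _; apply: sumr_ge0 => ? _; exact: sqr_ge0.
Qed.

Lemma mx_hsnorm_sqr_eq0 A : mx_hsnorm A ^+ 2 = 0 -> A = 0.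
Proof.
move=> A0; apply/matrixP => i j; rewrite mxE.
have := scalar_abs_sqr_le_mx_hsnorm A i j; rewrite A0 scalar_abs_sqr => h.
have re2 := sqr_ge0 (scalar_re (A i j)); have im2 := sqr_ge0 (scalar_im (A i j)).
apply: scalar_eq; rewrite ?scalar_re0 ?scalar_im0; apply/eqP.
  by rewrite -sqrf_eq0 eq_le re2 andbT; lra.
by rewrite -sqrf_eq0 eq_le im2 andbT; lra.
Qed.

Lemma mx_hsnorm0 : mx_hsnorm (0 : 'M[K]_(p, q)) = 0.
Proof.
apply/eqP; rewrite -sqrf_eq0 mx_hsnorm_sqr big1 // => i _; rewrite big1 // => j _.
by rewrite mxE scalar_abs_sqr scalar_re0 scalar_im0 expr0n addr0.
Qed.

Lemma mx_hsnormZ_sqr (a : K) A : mx_hsnorm (a *: A) ^+ 2 = scalar_abs a ^+ 2 * mx_hsnorm A ^+ 2.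
Proof.
rewrite !mx_hsnorm_sqr mulr_sumr; apply: eq_bigr => i _.
by rewrite mulr_sumr; apply: eq_bigr => j _; rewrite mxE scalar_absM exprMn.
Qed.

Lemma mx_hsnormD_sqr A B :
  mx_hsnorm (A + B) ^+ 2 <= 2 * (mx_hsnorm A ^+ 2 + mx_hsnorm B ^+ 2).
Proof.
rewrite !mx_hsnorm_sqr -big_split /= mulr_sumr; apply: ler_sum => i _.
rewrite -big_split /= mulr_sumr; apply: ler_sum => j _.
by rewrite mxE scalar_abs_sqrD.
Qed.

End AnySize.

(** The Hilbert-Schmidt norm dominates the operator norm on vectors. *)
Lemma mx_hsnorm_mulmx_sqr p q (A : 'M[K]_(p, q)) (v : 'cV[K]_q) :
  mx_hsnorm (A *m v) ^+ 2 <= mx_hsnorm A ^+ 2 * mx_hsnorm v ^+ 2.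
Proof.
rewrite !mx_hsnorm_sqr mulr_suml; apply: ler_sum => i _.
rewrite big_ord1 mxE.
have -> : \sum_(j < q) \sum_(l < 1) scalar_abs (v j l) ^+ 2 =
    \sum_(j < q) scalar_abs (v j 0) ^+ 2.
  by apply: eq_bigr => j _; rewrite big_ord1.
apply: le_trans (sum_sqr_CauchySchwarz _ _).
rewrite ler_sqr ?nnegrE ?scalar_abs_ge0 //; last first.
  by apply: sumr_ge0 => j _; rewrite mulr_ge0 ?scalar_abs_ge0.
apply: (le_trans (scalar_abs_sum _ _)).
by apply: ler_sum => j _; rewrite scalar_absM.
Qed.

End HSNorm.

(** * Measurable matrix functions and their norms *)

Section MeasurableMatrices.
Set Implicit Arguments.
Unset Strict Implicit.
Context (d : measure_display) (X : measurableType d) (R : realType).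
Context (m : {measure set X -> \bar R}) (k : scalar_kind).
Local Notation K := (scalar_field R k).

Lemma measurable_mx_const p q (A : 'M[K]_(p, q)) : measurable_mx (fun _ : X => A).
Proof. by move=> i j; split; exact: measurable_cst. Qed.

Lemma measurable_mx_mul p q r (F : X -> 'M[K]_(p, q)) (G : X -> 'M[K]_(q, r)) :
  measurable_mx F -> measurable_mx G -> measurable_mx (fun x => F x *m G x).
Proof.
move=> mF mG i j; split.
  under eq_fun do rewrite mxE scalar_re_sum.
  apply: measurable_sum => l; under eq_fun do rewrite scalar_reM.
  by apply: measurable_funB; apply: measurable_funM;
    (try exact: (mF _ _).1); (try exact: (mF _ _).2);
    (try exact: (mG _ _).1); (try exact: (mG _ _).2).
under eq_fun do rewrite mxE scalar_im_sum.
apply: measurable_sum => l; under eq_fun do rewrite scalar_imM.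
by apply: measurable_funD; apply: measurable_funM;
  (try exact: (mF _ _).1); (try exact: (mF _ _).2);
  (try exact: (mG _ _).1); (try exact: (mG _ _).2).
Qed.

Lemma measurable_mxZD p q (a : K) (F G : X -> 'M[K]_(p, q)) :
  measurable_mx F -> measurable_mx G -> measurable_mx (fun x => a *: F x + G x).
Proof.
move=> mF mG i j; have [mFr mFi] := mF i j; have [mGr mGi] := mG i j; split.
  under eq_fun do rewrite mxE scalar_reD mxE scalar_reM.
  apply: measurable_funD => //.
  by apply: measurable_funB; apply: measurable_funM => //; exact: measurable_cst.
under eq_fun do rewrite mxE scalar_imD mxE scalar_imM.
apply: measurable_funD => //.
by apply: measurable_funD; apply: measurable_funM => //; exact: measurable_cst.
Qed.

Lemma measurable_mx_hsnorm_sqr p q (F : X -> 'M[K]_(p, q)) :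
  measurable_mx F -> measurable_fun setT (fun x => mx_hsnorm (F x) ^+ 2).
Proof.
move=> mF; under eq_fun do rewrite mx_hsnorm_sqr.
apply: measurable_sum => i; apply: measurable_sum => j.
under eq_fun do rewrite scalar_abs_sqr.
by apply: measurable_funD; apply: measurable_funX; have [] := mF i j.
Qed.

Lemma mx_Lnorm2E p q (F : X -> 'M[K]_(p, q)) :
  mx_Lnorm m 2%:E F = sqrte (\int[m]_x (mx_hsnorm (F x) ^+ 2)%:E).
Proof.
rewrite /mx_Lnorm unlock poweR12_sqrt; last first.
  by apply: integral_ge0 => x _; exact: poweR_ge0.
congr sqrte; apply: eq_integral => x _ /=.
by rewrite ger0_norm ?mx_hsnorm_ge0 // powR_mulrn ?mx_hsnorm_ge0.
Qed.

Lemma integral_mx_hsnorm_sqr_ge0 p q (F : X -> 'M[K]_(p, q)) :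
  (0 <= \int[m]_x (mx_hsnorm (F x) ^+ 2)%:E)%E.
Proof. by apply: integral_ge0 => x _; rewrite lee_fin sqr_ge0. Qed.

Lemma mx_Lnorm2_sqr p q (F : X -> 'M[K]_(p, q)) :
  (mx_Lnorm m 2%:E F ^+ 2 = \int[m]_x (mx_hsnorm (F x) ^+ 2)%:E)%E.
Proof. by rewrite mx_Lnorm2E sqr_sqrte ?integral_mx_hsnorm_sqr_ge0. Qed.

Lemma mx_Lnorm_ge0 r p q (F : X -> 'M[K]_(p, q)) : (0 <= mx_Lnorm m r F)%E.
Proof. exact: Lnorm_ge0. Qed.

Lemma mx_Lnorm2_lty p q (F : X -> 'M[K]_(p, q)) :
  (mx_Lnorm m 2%:E F < +oo <-> \int[m]_x (mx_hsnorm (F x) ^+ 2)%:E < +oo)%E.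
Proof.
rewrite mx_Lnorm2E; case: (integral _ _ _) (integral_mx_hsnorm_sqr_ge0 F) => //= r r0.
by rewrite !ltry.
Qed.

Lemma mx_Lnorm2_le p q (F : X -> 'M[K]_(p, q)) (M : R) : 0 <= M ->
  (mx_Lnorm m 2%:E F <= M%:E <-> \int[m]_x (mx_hsnorm (F x) ^+ 2)%:E <= (M ^+ 2)%:E)%E.
Proof.
move=> M0; rewrite mx_Lnorm2E.
have -> : M%:E = sqrte (M ^+ 2)%:E by rewrite /= sqrtr_sqr ger0_norm.
by rewrite lee_sqrt // lee_fin sqr_ge0.
Qed.

(** The essential supremum bounds the function almost everywhere, also when the
    whole space is a null set, where the norm is zero by convention. *)
Lemma ae_le_mx_Lnormy p q (F : X -> 'M[K]_(p, q)) :
  \forall x \ae m, ((mx_hsnorm (F x))%:E <= mx_Lnorm m +oo F)%E.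
Proof.
rewrite /mx_Lnorm unlock; case: ifPn => m0.
  have := ess_sup_ge m (abse \o (EFin \o (fun x => mx_hsnorm (F x)))).
  by apply: filterS => x; apply: le_trans; rewrite lee_fin ler_norm.
exists setT; split => //; apply/eqP.
by rewrite eq_le measure_ge0 leNgt m0.
Qed.

End MeasurableMatrices.

(** * Square integrable functions *)

Section L2.
Set Implicit Arguments.
Unset Strict Implicit.
Context (d : measure_display) (X : measurableType d) (R : realType).
Context (m : {measure set X -> \bar R}) (k : scalar_kind).
Local Notation K := (scalar_field R k).

Lemma scalar_re_integral (h : X -> K) :
  scalar_re (scalar_integral m h) = \int[m]_x scalar_re (h x).
Proof. by rewrite /scalar_re /scalar_integral; case: k h. Qed.

Lemma scalar_im_integral (h : X -> K) :
  scalar_im (scalar_integral m h) = \int[m]_x scalar_im (h x).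
Proof.
rewrite /scalar_im /scalar_integral; case: k h => //= h.
by rewrite Rintegral_cst // mul0r.
Qed.

(** Integrability of the real and the imaginary part; for real scalars the
    second condition is trivial. *)
Definition scalar_integrable (h : X -> K) : Prop :=
  m.-integrable setT (EFin \o (fun x => scalar_re (h x))) /\
  m.-integrable setT (EFin \o (fun x => scalar_im (h x))).

Lemma integrableZl_EFin (a : R) (h : X -> R) :
  m.-integrable setT (EFin \o h) -> m.-integrable setT (EFin \o (fun x => a * h x)).
Proof. by move=> ih; apply: eq_integrable (integrableZl measurableT a ih). Qed.

Lemma scalar_integralZD (a : K) (g h : X -> K) :
  scalar_integrable g -> scalar_integrable h ->
  scalar_integral m (fun x => a * g x + h x) =
    a * scalar_integral m g + scalar_integral m h.
Proof.
move=> [gr gi] [hr hi]; have iZ := integrableZl_EFin.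
have iZB b c : m.-integrable setT
    (EFin \o (fun x => b * scalar_re (g x) - c * scalar_im (g x))).
  by apply: eq_integrable (integrableB measurableT (iZ b _ gr) (iZ c _ gi)).
have iZD b c : m.-integrable setT
    (EFin \o (fun x => b * scalar_im (g x) + c * scalar_re (g x))).
  by apply: eq_integrable (integrableD measurableT (iZ b _ gi) (iZ c _ gr)).
apply: scalar_eq.
  rewrite scalar_reD scalar_reM !scalar_re_integral scalar_im_integral.
  under eq_Rintegral do rewrite scalar_reD scalar_reM.
  rewrite RintegralD // RintegralB //; try exact: iZ.
  by rewrite !RintegralZl.
rewrite scalar_imD scalar_imM !scalar_im_integral scalar_re_integral.
under eq_Rintegral do rewrite scalar_imD scalar_imM.
rewrite RintegralD // RintegralD //; try exact: iZ.
by rewrite !RintegralZl.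
Qed.

Lemma scalar_integral_conj (h : X -> K) : scalar_integrable h ->
  scalar_integral m (fun x => scalar_conj (h x)) = scalar_conj (scalar_integral m h).
Proof.
move=> [_ hi]; apply: scalar_eq.
  rewrite scalar_re_conj !scalar_re_integral.
  by under eq_Rintegral do rewrite scalar_re_conj.
rewrite scalar_im_conj !scalar_im_integral.
under eq_Rintegral do rewrite scalar_im_conj -mulN1r.
by rewrite RintegralZl // mulN1r.
Qed.

Context (n : nat).
Implicit Types (f g h : X -> 'cV[K]_n).
Local Notation L2 := (@Lspace_mx d X R m k n 2%:E).
Local Notation inner := (@L2_inner d X R m k n).

Lemma mx_hsnorm_sqr_cV (v : 'cV[K]_n) :
  mx_hsnorm v ^+ 2 = \sum_(i < n) scalar_abs (v i 0) ^+ 2.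
Proof. by rewrite mx_hsnorm_sqr; apply: eq_bigr => i _; rewrite big_ord1. Qed.

Lemma Lspace_mx2_integrable f : L2 f ->
  m.-integrable setT (EFin \o (fun x => mx_hsnorm (f x) ^+ 2)).
Proof.
move=> [mf /mx_Lnorm2_lty fy]; apply/integrableP; split.
  exact/measurable_EFinP/measurable_mx_hsnorm_sqr.
by under eq_integral do rewrite /= ger0_norm ?sqr_ge0 //.
Qed.

Lemma integral_mx_hsnorm_sqrZD (a : K) f g :
  measurable_mx f -> measurable_mx g ->
  (\int[m]_x (mx_hsnorm (a *: f x + g x) ^+ 2)%:E <=
   (2 * scalar_abs a ^+ 2)%:E * \int[m]_x (mx_hsnorm (f x) ^+ 2)%:E +
   2%:E * \int[m]_x (mx_hsnorm (g x) ^+ 2)%:E)%E.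
Proof.
move=> mf mg.
have mF := measurable_mx_hsnorm_sqr mf; have mG := measurable_mx_hsnorm_sqr mg.
have ge0 c (F : X -> 'cV[K]_n) x : 0 <= c ->
    (0 <= c%:E * (mx_hsnorm (F x) ^+ 2)%:E)%E.
  by move=> c0; rewrite -EFinM lee_fin mulr_ge0 ?sqr_ge0.
have a0 : 0 <= 2 * scalar_abs a ^+ 2 by rewrite mulr_ge0 ?sqr_ge0.
have mZ c (F : X -> 'cV[K]_n) : measurable_fun setT (fun x => mx_hsnorm (F x) ^+ 2) ->
    measurable_fun setT (fun x => c%:E * (mx_hsnorm (F x) ^+ 2)%:E)%E.
  by move=> mH; apply/measurable_EFinP/measurable_funM => //; exact: measurable_cst.
rewrite -!ge0_integralZl_EFin //; try (by move=> x _; rewrite lee_fin sqr_ge0);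
  try (exact/measurable_EFinP).
rewrite -ge0_integralD //; try (by move=> x _; exact: ge0); try exact: mZ.
apply: ge0_le_integral => //.
- by move=> x _; rewrite lee_fin sqr_ge0.
- exact/measurable_EFinP/measurable_mx_hsnorm_sqr/measurable_mxZD.
- by apply: emeasurable_funD; exact: mZ.
move=> x _; rewrite lee_fin (le_trans (mx_hsnormD_sqr _ _)) //.
by rewrite mx_hsnormZ_sqr mulrDr mulrA.
Qed.

Lemma Lspace_mx2ZD (a : K) f g : L2 f -> L2 g -> L2 (fun x => a *: f x + g x).
Proof.
move=> [mf /mx_Lnorm2_lty fy] [mg /mx_Lnorm2_lty gy]; split.
  exact: measurable_mxZD.
apply/mx_Lnorm2_lty; apply: le_lt_trans (integral_mx_hsnorm_sqrZD a mf mg) _.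
apply: lte_add_pinfty; apply: lte_mul_pinfty => //.
by rewrite lee_fin mulr_ge0 // sqr_ge0.
Qed.

Lemma integral_mx_hsnorm0 p q :
  (\int[m]_x (mx_hsnorm (0 : 'M[K]_(p, q)) ^+ 2)%:E = 0)%E.
Proof. by rewrite mx_hsnorm0 expr0n /= integral0. Qed.

Lemma Lspace_mx2_0 : L2 (fun=> 0).
Proof.
split; first exact: measurable_mx_const.
by apply/mx_Lnorm2_lty; rewrite integral_mx_hsnorm0.
Qed.

Lemma Lspace_mx2Z (a : K) f : L2 f -> L2 (fun x => a *: f x).
Proof.
move=> Lf; have := Lspace_mx2ZD a Lf Lspace_mx2_0.
by under eq_fun do rewrite addr0.
Qed.

Lemma Lspace_mx2_lincomb J (s : seq J) (c : J -> K) (e : J -> X -> 'cV[K]_n) :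
  (forall j, L2 (e j)) -> L2 (fun x => \sum_(j <- s) c j *: e j x).
Proof.
move=> Le; elim: s => [|j s IH].
  by under eq_fun do rewrite big_nil; exact: Lspace_mx2_0.
by under eq_fun do rewrite big_cons; exact: Lspace_mx2ZD.
Qed.

(** * The inner product of square integrable functions *)

Lemma L2_inner_integrable f g : L2 f -> L2 g ->
  scalar_integrable (fun x => \sum_(i < n) scalar_conj (f x i 0) * g x i 0).
Proof.
move=> Lf Lg; have ifg := integrableD measurableT (Lspace_mx2_integrable Lf)
  (Lspace_mx2_integrable Lg).
have [mf _] := Lf; have [mg _] := Lg.
have dom x : scalar_abs (\sum_(i < n) scalar_conj (f x i 0) * g x i 0) <=
    mx_hsnorm (f x) ^+ 2 + mx_hsnorm (g x) ^+ 2.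
  apply: (le_trans (scalar_abs_sum _ _)).
  rewrite !mx_hsnorm_sqr_cV -big_split /=; apply: ler_sum => i _.
  rewrite scalar_absM.
  have -> : scalar_abs (scalar_conj (f x i 0)) = scalar_abs (f x i 0).
    apply/eqP; rewrite -(@eqrXn2 _ 2) ?scalar_abs_ge0 // !scalar_abs_sqr.
    by rewrite scalar_re_conj scalar_im_conj sqrrN.
  have := sqr_ge0 (scalar_abs (f x i 0) - scalar_abs (g x i 0)).
  have := scalar_abs_ge0 (f x i 0); have := scalar_abs_ge0 (g x i 0); nra.
split; apply: le_integrable ifg => //.
- apply/measurable_EFinP; under eq_fun do rewrite scalar_re_sum.
  apply: measurable_sum => i.
  under eq_fun do rewrite scalar_reM scalar_re_conj scalar_im_conj mulNr.
  by apply: measurable_funB; [apply: measurable_funM|apply: measurable_funN;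
    apply: measurable_funM]; (try exact: (mf _ _).1); (try exact: (mf _ _).2);
    (try exact: (mg _ _).1); (try exact: (mg _ _).2).
- move=> x _; rewrite /= lee_fin.
  rewrite [leRHS]ger0_norm ?addr_ge0 ?sqr_ge0 //; apply: le_trans (dom x).
  exact: scalar_re_le_abs.
- apply/measurable_EFinP; under eq_fun do rewrite scalar_im_sum.
  apply: measurable_sum => i.
  under eq_fun do rewrite scalar_imM scalar_re_conj scalar_im_conj mulNr.
  by apply: measurable_funB; apply: measurable_funM;
    (try exact: (mf _ _).1); (try exact: (mf _ _).2);
    (try exact: (mg _ _).1); (try exact: (mg _ _).2).
- move=> x _; rewrite /= lee_fin.
  rewrite [leRHS]ger0_norm ?addr_ge0 ?sqr_ge0 //; apply: le_trans (dom x).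
  exact: scalar_im_le_abs.
Qed.

Lemma L2_innerC f g : L2 f -> L2 g -> inner g f = scalar_conj (inner f g).
Proof.
move=> Lf Lg; rewrite -scalar_integral_conj; last exact: L2_inner_integrable.
congr scalar_integral; apply/funext => x; rewrite scalar_conj_sum.
by apply: eq_bigr => i _; rewrite scalar_conjM scalar_conjK mulrC.
Qed.

Lemma L2_innerZDr (a : K) f g h : L2 f -> L2 g -> L2 h ->
  inner f (fun x => a *: g x + h x) = a * inner f g + inner f h.
Proof.
move=> Lf Lg Lh; rewrite -scalar_integralZD; try exact: L2_inner_integrable.
congr scalar_integral; apply/funext => x; rewrite mulr_sumr -big_split /=.
by apply: eq_bigr => i _; rewrite !mxE mulrDr mulrCA.
Qed.

Lemma L2_inner0r f : inner f (fun=> 0) = 0.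
Proof.
have h0 x : \sum_(i < n) scalar_conj (f x i 0) * (0 : 'cV[K]_n) i 0 = 0.
  by rewrite big1 // => i _; rewrite mxE mulr0.
apply: scalar_eq.
  rewrite scalar_re_integral scalar_re0.
  by under eq_Rintegral do rewrite h0 scalar_re0; rewrite Rintegral_cst // mul0r.
rewrite scalar_im_integral scalar_im0.
by under eq_Rintegral do rewrite h0 scalar_im0; rewrite Rintegral_cst // mul0r.
Qed.

Lemma L2_innerZr (a : K) f g : L2 f -> L2 g ->
  inner f (fun x => a *: g x) = a * inner f g.
Proof.
move=> Lf Lg; rewrite -[RHS]addr0 -(L2_inner0r f) -L2_innerZDr //; last exact: Lspace_mx2_0.
by congr L2_inner; apply/funext => x; rewrite addr0.
Qed.

Lemma L2_inner_lincomb J (s : seq J) (c : J -> K) (e : J -> X -> 'cV[K]_n) f :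
  L2 f -> (forall j, L2 (e j)) ->
  inner f (fun x => \sum_(j <- s) c j *: e j x) = \sum_(j <- s) c j * inner f (e j).
Proof.
move=> Lf Le; elim: s => [|j s IH].
  by under eq_fun do rewrite big_nil; rewrite L2_inner0r big_nil.
under eq_fun do rewrite big_cons.
by rewrite L2_innerZDr ?big_cons ?IH //; exact: Lspace_mx2_lincomb.
Qed.

Lemma L2_inner_self f : L2 f ->
  inner f f = scalar_mk k (fine (\int[m]_x (mx_hsnorm (f x) ^+ 2)%:E)) 0.
Proof.
move=> Lf; rewrite /L2_inner.
have -> : (fun x => \sum_(i < n) scalar_conj (f x i 0) * f x i 0) =
    (fun x => scalar_mk k (mx_hsnorm (f x) ^+ 2) 0).
  apply/funext => x; rewrite mx_hsnorm_sqr_cV scalar_mk0_sum.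
  by apply: eq_bigr => i _; rewrite scalar_mul_conj.
apply: scalar_eq.
  rewrite scalar_re_integral scalar_re_mk.
  by under eq_Rintegral do rewrite scalar_re_mk.
rewrite scalar_im_integral scalar_im_mk0.
by under eq_Rintegral do rewrite scalar_im_mk0; rewrite Rintegral_cst // mul0r.
Qed.

(** Pythagoras' theorem. *)
Lemma integral_lincomb_orthonormal (J : finType) (c : J -> K)
    (e : J -> X -> 'cV[K]_n) :
  (forall j, L2 (e j)) -> (forall j l, inner (e j) (e l) = (j == l)%:R) ->
  (\int[m]_x (mx_hsnorm (\sum_j c j *: e j x) ^+ 2)%:E =
   (\sum_j scalar_abs (c j) ^+ 2)%:E)%E.
Proof.
move=> Le orth; set f := fun x => \sum_j c j *: e j x.
have Lf : L2 f by exact: Lspace_mx2_lincomb.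
have fe j : inner (e j) f = c j.
  rewrite L2_inner_lincomb // (bigD1 j) //= orth eqxx mulr1 big1 ?addr0 // => l lj.
  by rewrite orth eq_sym (negbTE lj) mulr0.
have ff : inner f f = scalar_mk k (\sum_j scalar_abs (c j) ^+ 2) 0.
  rewrite {2}/f L2_inner_lincomb // scalar_mk0_sum; apply: eq_bigr => j _.
  by rewrite L2_innerC // fe mulrC scalar_mul_conj.
have := congr1 (@scalar_re R k) ff.
rewrite L2_inner_self // !scalar_re_mk => <-; rewrite fineK //.
by have /integrable_fin_num := Lspace_mx2_integrable Lf; apply.
Qed.

End L2.

(** * Existence of orthonormal bases *)

Section OrthonormalBasis.
Set Implicit Arguments.
Unset Strict Implicit.
Context (d : measure_display) (X : measurableType d) (R : realType).
Context (m : {measure set X -> \bar R}) (k : scalar_kind) (n : nat).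
Local Notation K := (scalar_field R k).
Local Notation L2 := (@Lspace_mx d X R m k n 2%:E).
Local Notation inner := (@L2_inner d X R m k n).

Lemma integral_mx_hsnorm_sqr_eq0 (f : X -> 'cV[K]_n) : measurable_mx f ->
  (\int[m]_x (mx_hsnorm (f x) ^+ 2)%:E = 0)%E -> \forall x \ae m, f x = 0.
Proof.
move=> mf f0.
have mF : measurable_fun setT (EFin \o (fun x => mx_hsnorm (f x) ^+ 2)).
  exact/measurable_EFinP/measurable_mx_hsnorm_sqr.
have /(ae_eq_integral_abs m measurableT mF) :
    (\int[m]_x `|(mx_hsnorm (f x) ^+ 2)%:E| = 0)%E.
  by rewrite -[RHS]f0; apply: eq_integral => x _; rewrite /= ger0_norm ?sqr_ge0.
by apply: filterS => x /(_ I) [] /mx_hsnorm_sqr_eq0.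
Qed.

(** Orthonormal sets of functions, without completeness. *)
Definition orthonormal_system (E : set (X -> 'cV[K]_n)) : Prop :=
  [/\ E `<=` L2, forall e, E e -> inner e e = 1 &
      forall e e', E e -> E e' -> e <> e' -> inner e e' = 0].

Lemma orthonormal_basis_system E : orthonormal_basis m E -> orthonormal_system E.
Proof. by case. Qed.

Lemma orthonormal_systemU1 (E : set (X -> 'cV[K]_n)) g :
  orthonormal_system E -> L2 g -> inner g g = 1 ->
  (forall e, E e -> inner e g = 0) -> orthonormal_system (E `|` [set g]).
Proof.
move=> [EL E1 E0] Lg g1 Eg; split => [e [/EL|->]|e [/E1|->]|e e' [Ee|->] [Ee'|->]] //.
- exact: E0.
- by move=> _; exact: Eg.
- by move=> _; rewrite L2_innerC ?Eg ?scalar_conj0 //; exact: EL.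
Qed.

(** A maximal orthonormal system is complete: a nonzero function orthogonal to
    all its members could be normalized and added to it. *)
Lemma maximal_orthonormal_system_basis (E : set (X -> 'cV[K]_n)) :
  orthonormal_system E -> (forall F, E `<` F -> ~ orthonormal_system F) ->
  orthonormal_basis m E.
Proof.
move=> oE Emax; have [EL E1 E0] := oE; split => // f Lf Ef.
set r := fine (\int[m]_x (mx_hsnorm (f x) ^+ 2)%:E)%E.
have ff : inner f f = scalar_mk k r 0 by exact: L2_inner_self.
have rE : (\int[m]_x (mx_hsnorm (f x) ^+ 2)%:E = r%:E)%E.
  by rewrite fineK //; have /integrable_fin_num := Lspace_mx2_integrable Lf; apply.
have [r0|r0] := eqVneq r 0.
  by apply: integral_mx_hsnorm_sqr_eq0; [case: Lf|rewrite rE r0].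
have r_gt0 : 0 < r.
  by rewrite lt_neqAle eq_sym r0 -lee_fin -rE integral_mx_hsnorm_sqr_ge0.
set a : K := scalar_mk k (Num.sqrt r)^-1 0.
set g := fun x => a *: f x.
have Lg : L2 g by exact: Lspace_mx2Z.
have gf : inner g f = scalar_mk k (Num.sqrt r) 0.
  rewrite L2_innerC // L2_innerZr // ff scalar_mk0M.
  have -> : (Num.sqrt r)^-1 * r = Num.sqrt r.
    rewrite -{2}(sqr_sqrtr (ltW r_gt0)) expr2 mulKf //.
    by rewrite gt_eqF // sqrtr_gt0.
  by apply: scalar_eq; rewrite ?scalar_re_conj ?scalar_im_conj ?scalar_im_mk0 ?oppr0.
have gg : inner g g = 1.
  rewrite L2_innerZr // gf scalar_mk0M mulVf ?scalar_mk10 //.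
  by rewrite gt_eqF // sqrtr_gt0.
have Eg e : E e -> inner e g = 0.
  by move=> Ee; rewrite L2_innerZr ?Ef ?mulr0 //; exact: EL.
exfalso; apply: (Emax (E `|` [set g])); last exact: orthonormal_systemU1.
split; first exact: subsetUl.
move=> EgE; have /Eg : E g by apply: EgE; right.
by rewrite gg; move/eqP; rewrite oner_eq0.
Qed.

(** Zorn's lemma applies because the union of a chain of orthonormal systems is
    orthonormal: any two of its members lie in a common system. *)
Lemma orthonormal_basis_exists : exists E : set (X -> 'cV[K]_n), orthonormal_basis m E.
Proof.
have [F FE Ftot|E [oE Emax]] := @Zorn_bigcup _ orthonormal_system; last first.
  by exists E; exact: maximal_orthonormal_system_basis.
split.
- by move=> e [A FA Ae]; have [AL _ _] := FE _ FA; exact: AL.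
- by move=> e [A FA Ae]; have [_ A1 _] := FE _ FA; exact: A1.
- move=> e e' [A FA Ae] [B FB Be'].
  have [AB|BA] := Ftot _ _ FA FB.
    by have [_ _ B0] := FE _ FB; apply: B0 => //; exact: AB.
  by have [_ _ A0] := FE _ FA; apply: A0 => //; exact: BA.
Qed.

End OrthonormalBasis.

(** * Bounded operators on square integrable functions *)

Section BoundedOperators.
Set Implicit Arguments.
Unset Strict Implicit.
Context (d : measure_display) (X : measurableType d) (R : realType).
Context (m : {measure set X -> \bar R}) (k : scalar_kind) (n : nat).
Local Notation K := (scalar_field R k).
Local Notation L2 := (@Lspace_mx d X R m k n 2%:E).
Local Notation inner := (@L2_inner d X R m k n).
Context (s : \bar R) (T : (X -> 'cV[K]_n) -> (X -> 'cV[K]_n)).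
Hypothesis T_bounded : bounded_operator m 2%:E s T.

(** Linearity is only stated for combinations a f + g; T 0 = 0 follows from
    T 0 = T (1 0 + 0) = T 0 + T 0. *)
Lemma bounded_operator0 : \forall x \ae m, T (fun=> 0) x = 0.
Proof.
have L0 := @Lspace_mx2_0 _ _ _ m k n.
have := bounded_operator_linear T_bounded 1 L0 L0.
have -> : (fun y : X => 1 *: (0 : 'cV[K]_n) + 0) = (fun=> 0).
  by apply/funext => y; rewrite scaler0 addr0.
apply: filterS => x; rewrite scale1r => /eqP.
by rewrite -subr_eq subrr eq_sym => /eqP.
Qed.

Lemma bounded_operator_lincomb J (r : seq J) (c : J -> K) (e : J -> X -> 'cV[K]_n) :
  (forall j, L2 (e j)) ->
  \forall x \ae m, T (fun y => \sum_(j <- r) c j *: e j y) x =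
                   \sum_(j <- r) c j *: T (e j) x.
Proof.
move=> Le; elim: r => [|j r IH].
  have -> : (fun y => \sum_(j <- [::]) c j *: e j y) = (fun=> 0).
    by apply/funext => y; rewrite big_nil.
  by apply: filterS bounded_operator0 => x ->; rewrite big_nil.
have -> : (fun y => \sum_(i <- j :: r) c i *: e i y) =
    (fun y => c j *: e j y + \sum_(i <- r) c i *: e i y).
  by apply/funext => y; rewrite big_cons.
have := bounded_operator_linear T_bounded (c j) (Le j) (Lspace_mx2_lincomb r c Le).
by apply: filterS2 IH => x -> ->; rewrite big_cons.
Qed.

Lemma bounded_operatorZ (a : K) f : L2 f ->
  \forall x \ae m, T (fun y => a *: f y) x = a *: T f x.
Proof.
move=> Lf; have := bounded_operator_lincomb [:: tt] (fun=> a) (fun=> Lf).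
have -> : (fun y => \sum_(j <- [:: tt]) a *: f y) = (fun y => a *: f y).
  by apply/funext => y; rewrite big_seq1.
by apply: filterS => x ->; rewrite big_seq1.
Qed.

Lemma bounded_operator_bound_ge0 : exists2 C : R, 0 <= C &
  forall f, L2 f -> (mx_Lnorm m s (T f) <= C%:E * mx_Lnorm m 2%:E f)%E.
Proof.
have [C CP] := bounded_operator_bound T_bounded.
exists `|C| => // f Lf; apply: (le_trans (CP f Lf)).
by apply: lee_wpmul2r; [exact: mx_Lnorm_ge0|rewrite lee_fin ler_norm].
Qed.

Lemma operator_norm_ge0 : (0 <= operator_norm m 2%:E s T)%E.
Proof.
apply: le_trans (mx_Lnorm_ge0 m s (T (fun=> 0))) _.
apply: ereal_sup_ubound; exists (fun=> 0) => //; split; first exact: Lspace_mx2_0.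
by rewrite (mx_Lnorm2_le _ _ ler01) integral_mx_hsnorm0 lee_fin sqr_ge0.
Qed.

Lemma operator_norm_fin_num : operator_norm m 2%:E s T \is a fin_num.
Proof.
rewrite ge0_fin_numE ?operator_norm_ge0 //.
have [C C0 CP] := bounded_operator_bound_ge0.
apply: (@le_lt_trans _ _ C%:E); last exact: ltry.
apply: ge_ereal_sup => _ [f [Lf f1] <-]; apply: (le_trans (CP f Lf)).
by rewrite -[leRHS]mule1; apply: lee_wpmul2l.
Qed.

(** A function of norm at most r enters the supremum defining the operator norm
    once it is divided by r. *)
Lemma mx_Lnorm_le_operator_norm f (r : R) : L2 f -> 0 < r ->
  (\int[m]_x (mx_hsnorm (f x) ^+ 2)%:E <= (r ^+ 2)%:E)%E ->
  (mx_Lnorm m s (T (fun x => scalar_mk k r^-1 0 *: f x)) <= operator_norm m 2%:E s T)%E.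
Proof.
move=> Lf r0 fr; apply: ereal_sup_ubound.
exists (fun x => scalar_mk k r^-1 0 *: f x) => //; split; first exact: Lspace_mx2Z.
rewrite (mx_Lnorm2_le _ _ ler01).
under eq_integral do rewrite mx_hsnormZ_sqr scalar_abs_mk0_sqr EFinM.
rewrite ge0_integralZl_EFin ?sqr_ge0 //; last first.
- exact/measurable_EFinP/measurable_mx_hsnorm_sqr/Lf.1.
- by move=> x _; rewrite lee_fin sqr_ge0.
have -> : (1 ^+ 2 : R)%:E = ((r^-1 ^+ 2)%:E * (r ^+ 2)%:E)%E.
  by rewrite -EFinM -exprMn mulVf ?gt_eqF.
by apply: lee_wpmul2l; rewrite // lee_fin sqr_ge0.
Qed.

End BoundedOperators.

(** * The Hilbert-Schmidt estimate *)

Section HilbertSchmidt.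
Set Implicit Arguments.
Unset Strict Implicit.
Context (d : measure_display) (X : measurableType d) (R : realType).
Context (m : {measure set X -> \bar R}) (k : scalar_kind) (n : nat).
Local Notation K := (scalar_field R k).
Local Notation L2 := (@Lspace_mx d X R m k n 2%:E).
Local Notation inner := (@L2_inner d X R m k n).

Lemma ae_forall_countable (Q : countType) (P : Q -> X -> Prop) :
  (forall q, \forall x \ae m, P q x) -> \forall x \ae m, forall q, P q x.
Proof.
move=> H.
have : \forall x \ae m, forall i, if unpickle i is Some q then P q x else True.
  by apply: ae_foralln => i; case: unpickle => [q|]; [exact: H|exact: aeW].
by apply: filterS => x Hx q; have := Hx (pickle q); rewrite pickleK.
Qed.

Section Multiplication.
Context (V : X -> 'M[K]_n).
Hypothesis V_measurable : measurable_mx V.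
Hypothesis V_finite : (mx_Lnorm m 2%:E V < +oo)%E.

Lemma mx_Lnorm2_mul (f : X -> 'cV[K]_n) (M : R) : measurable_mx f -> 0 <= M ->
  (\forall x \ae m, mx_hsnorm (f x) <= M) ->
  (mx_Lnorm m 2%:E (fun x => V x *m f x) <= M%:E * mx_Lnorm m 2%:E V)%E.
Proof.
move=> mf M0 fM.
have /fineK <- : mx_Lnorm m 2%:E V \is a fin_num by rewrite ge0_fin_numE ?mx_Lnorm_ge0.
have v0 : 0 <= fine (mx_Lnorm m 2%:E V) by rewrite fine_ge0 ?mx_Lnorm_ge0.
rewrite -EFinM mx_Lnorm2_le ?mulr_ge0 // exprMn EFinM.
have -> : ((fine (mx_Lnorm m 2%:E V) ^+ 2)%:E = \int[m]_x (mx_hsnorm (V x) ^+ 2)%:E)%E.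
  by rewrite -mx_Lnorm2_sqr EFin_expe fineK // ge0_fin_numE ?mx_Lnorm_ge0.
have mV := measurable_mx_hsnorm_sqr V_measurable.
rewrite -ge0_integralZl_EFin ?sqr_ge0 //; last first.
- exact/measurable_EFinP.
- by move=> x _; rewrite lee_fin sqr_ge0.
apply: ae_ge0_le_integral => //.
- by move=> x _; rewrite lee_fin sqr_ge0.
- exact/measurable_EFinP/measurable_mx_hsnorm_sqr/measurable_mx_mul.
- by move=> x _; rewrite -EFinM lee_fin mulr_ge0 ?sqr_ge0.
- by apply/measurable_EFinP/measurable_funM => //; exact: measurable_cst.
apply: filterS fM => x fM _; rewrite -EFinM lee_fin.
apply: (le_trans (mx_hsnorm_mulmx_sqr _ _)); rewrite mulrC; apply: ler_wpM2r.
  exact: sqr_ge0.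
by rewrite ler_sqr ?nnegrE ?mx_hsnorm_ge0.
Qed.

Context (T : (X -> 'cV[K]_n) -> (X -> 'cV[K]_n)).
Hypothesis T_bounded : bounded_operator m 2%:E +oo%E T.

Lemma mx_Lnorm2_mul_operator (C : R) f : 0 <= C -> L2 f ->
  (mx_Lnorm m +oo (T f) <= C%:E * mx_Lnorm m 2%:E f)%E ->
  (mx_Lnorm m 2%:E (fun x => V x *m T f x) <=
    C%:E * mx_Lnorm m 2%:E f * mx_Lnorm m 2%:E V)%E.
Proof.
move=> C0 Lf Tf; have [mTf _] := bounded_operator_range T_bounded Lf.
have /fineK ffin : mx_Lnorm m 2%:E f \is a fin_num.
  by rewrite ge0_fin_numE ?mx_Lnorm_ge0 //; exact: Lf.2.
rewrite -ffin -EFinM; apply: mx_Lnorm2_mul => //.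
  by rewrite mulr_ge0 // fine_ge0 ?mx_Lnorm_ge0.
apply: filterS (ae_le_mx_Lnormy m (T f)) => x Tfx.
by rewrite -lee_fin (le_trans Tfx) // EFinM ffin.
Qed.

Lemma bounded_operator_mul :
  bounded_operator m 2%:E 2%:E (fun f x => V x *m T f x).
Proof.
have [C C0 CP] := bounded_operator_bound_ge0 T_bounded.
have VT f : L2 f -> (mx_Lnorm m 2%:E (fun x => (V x *m T f x)%R) <=
    C%:E * mx_Lnorm m 2%:E f * mx_Lnorm m 2%:E V)%E.
  by move=> Lf; apply: mx_Lnorm2_mul_operator => //; exact: CP.
have /fineK vfin : mx_Lnorm m 2%:E V \is a fin_num by rewrite ge0_fin_numE ?mx_Lnorm_ge0.
split.
- move=> f Lf; split.
    by apply: measurable_mx_mul => //; exact: (bounded_operator_range T_bounded Lf).1.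
  apply: (le_lt_trans (VT f Lf)); rewrite -vfin muleC.
  by apply: lte_mul_pinfty; rewrite ?lee_fin ?fine_ge0 ?mx_Lnorm_ge0 //;
    apply: lte_mul_pinfty; rewrite ?lee_fin //; exact: Lf.2.
- move=> f g Lf Lg fg; have := bounded_operator_ae T_bounded Lf Lg fg.
  by apply: filterS => x ->.
- move=> a f g Lf Lg; have := bounded_operator_linear T_bounded a Lf Lg.
  by apply: filterS => x ->; rewrite mulmxDr scalemxAr.
- exists (fine (mx_Lnorm m 2%:E V) * C) => f Lf; apply: (le_trans (VT f Lf)).
  by rewrite EFinM vfin muleC muleA.
Qed.

(* The operator norm is finite, so that nothing is lost by passing to reals. *)
Let t := fine (operator_norm m 2%:E +oo T).

Lemma fine_operator_norm_ge0 : 0 <= t.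
Proof. by rewrite fine_ge0 // operator_norm_ge0. Qed.

Lemma ae_operator_le f (r : R) : L2 f -> 0 < r ->
  (\int[m]_x (mx_hsnorm (f x) ^+ 2)%:E <= (r ^+ 2)%:E)%E ->
  \forall x \ae m, mx_hsnorm (T f x) <= t * r.
Proof.
move=> Lf r0 fr; have h := mx_Lnorm_le_operator_norm +oo%E T Lf r0 fr.
have := bounded_operatorZ T_bounded (scalar_mk k r^-1 0) Lf.
apply: filterS2 (ae_le_mx_Lnormy m (T (fun x => scalar_mk k r^-1 0 *: f x))) => x Tx TZ.
have {Tx}h := le_trans Tx h.
move: h; rewrite -(fineK (operator_norm_fin_num T_bounded)) lee_fin TZ => h.
have {}h : mx_hsnorm (scalar_mk k r^-1 0 *: T f x) ^+ 2 <= t ^+ 2.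
  by rewrite ler_sqr ?nnegrE ?mx_hsnorm_ge0 ?fine_operator_norm_ge0.
rewrite -ler_sqr ?nnegrE ?mx_hsnorm_ge0 ?mulr_ge0 ?fine_operator_norm_ge0 ?(ltW r0) //.
move: h; rewrite mx_hsnormZ_sqr scalar_abs_mk0_sqr exprMn exprVn.
by rewrite mulrC ler_pdivrMr ?exprn_gt0.
Qed.

Section OrthonormalFamily.
Context (N : nat) (e : 'I_N -> X -> 'cV[K]_n).
Hypothesis e_L2 : forall j, L2 (e j).
Hypothesis e_orth : forall j l, inner (e j) (e l) = (j == l)%:R.

(** A pair (q (j, false), q (j, true)) of rationals encodes the real and the
    imaginary part of the j-th coefficient. There are countably many such q, so
    a single null set serves all of them. *)
Lemma ae_rat_test_le : \forall x \ae m, forall q : {ffun 'I_N * bool -> rat},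
  mx_hsnorm (\sum_j scalar_mk k (ratr (q (j, false))) (ratr (q (j, true))) *: T (e j) x)
   <= t * Num.sqrt (\sum_p (ratr (q p) : R) ^+ 2).
Proof.
apply: ae_forall_countable => q.
set c := fun j => scalar_mk k (ratr (q (j, false)) : R) (ratr (q (j, true))).
set S := \sum_p (ratr (q p) : R) ^+ 2.
have S0 : 0 <= S by apply: sumr_ge0 => p _; exact: sqr_ge0.
have [Seq0|Sneq0] := eqVneq S 0.
  have q0 p : ratr (q p) = 0 :> R.
    apply/eqP; rewrite -sqrf_eq0; apply/eqP.
    exact: (psumr_eq0P (fun p _ => sqr_ge0 (ratr (q p) : R)) Seq0).
  (* All coefficients vanish, and the rescaling by sqrt S is not available. *)
  apply: aeW => x; rewrite big1 => [|j _]; last by rewrite !q0 scalar_mk00 scale0r.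
  by rewrite mx_hsnorm0 mulr_ge0 ?fine_operator_norm_ge0 ?sqrtr_ge0.
have r0 : 0 < Num.sqrt S by rewrite sqrtr_gt0 lt_neqAle eq_sym Sneq0.
have Le := Lspace_mx2_lincomb (index_enum 'I_N) c e_L2.
have cS : \sum_j scalar_abs (c j) ^+ 2 <= S.
  have -> : S = \sum_j \sum_(b : bool) (ratr (q (j, b)) : R) ^+ 2.
    by rewrite pair_big /=; apply: eq_bigr => -[].
  apply: ler_sum => j _; rewrite big_bool /= addrC; exact: scalar_abs_mk_sqr_le.
have := ae_operator_le Le r0.
rewrite integral_lincomb_orthonormal // sqr_sqrtr // lee_fin => /(_ cS).
have := bounded_operator_lincomb T_bounded (index_enum 'I_N) c e_L2.
by apply: filterS2 => x ->.
Qed.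

(** Bessel's inequality at almost every point: each of the n rows contributes at
    most t ^+ 2. *)
Lemma ae_sum_operator_sqr_le : \forall x \ae m,
  \sum_j mx_hsnorm (T (e j) x) ^+ 2 <= n%:R * t ^+ 2.
Proof.
apply: filterS ae_rat_test_le => x Hx.
under eq_bigr do rewrite mx_hsnorm_sqr_cV.
rewrite exchange_big /= mulr_natl -[in leRHS](card_ord n) -sumr_const.
apply: ler_sum => i _.
(* The real part of sum_j c_j z_j is the scalar product of the coordinates of
   c with the real numbers Re z_j and - Im z_j. *)
pose a (p : 'I_N * bool) := if p.2 then - scalar_im (T (e p.1) x i 0)
                            else scalar_re (T (e p.1) x i 0).
have -> : \sum_j scalar_abs (T (e j) x i 0) ^+ 2 = \sum_p a p ^+ 2.
  have -> : \sum_p a p ^+ 2 = \sum_j \sum_(b : bool) a (j, b) ^+ 2.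
    by rewrite pair_big /=; apply: eq_bigr => -[].
  by apply: eq_bigr => j _; rewrite big_bool /a /= sqrrN addrC scalar_abs_sqr.
apply: sum_sqr_le_of_rat_test; first exact: fine_operator_norm_ge0.
move=> q; have := Hx [ffun p => q p].
under [in leRHS]eq_bigr do rewrite ffunE; apply: le_trans.
set w := \sum_(j < N) _.
have -> : \sum_p ratr (q p) * a p = scalar_re (w i 0).
  rewrite summxE scalar_re_sum.
  have -> : \sum_p ratr (q p) * a p = \sum_j \sum_(b : bool) ratr (q (j, b)) * a (j, b).
    by rewrite pair_big /=; apply: eq_bigr => -[].
  apply: eq_bigr => j _; rewrite mxE scalar_re_mkM !ffunE big_bool /a /=.
  by rewrite mulrN addrC.
apply: (le_trans (ler_norm _)); apply: (le_trans (scalar_re_le_abs _)).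
by rewrite -ler_sqr ?nnegrE ?scalar_abs_ge0 ?mx_hsnorm_ge0 // scalar_abs_sqr_le_mx_hsnorm.
Qed.

Lemma sum_mul_operator_sqr_le :
  (\sum_j mx_Lnorm m 2%:E (fun x => (V x *m T (e j) x)%R) ^+ 2 <=
    (n%:R * t ^+ 2)%:E * mx_Lnorm m 2%:E V ^+ 2)%E.
Proof.
rewrite mx_Lnorm2_sqr.
under eq_bigr do rewrite mx_Lnorm2_sqr.
have mVT j : measurable_fun setT (fun x => (mx_hsnorm (V x *m T (e j) x) ^+ 2)%:E).
  apply/measurable_EFinP/measurable_mx_hsnorm_sqr/measurable_mx_mul => //.
  exact: (bounded_operator_range T_bounded (e_L2 j)).1.
have mV := measurable_mx_hsnorm_sqr V_measurable.
have c0 : 0 <= n%:R * t ^+ 2 by rewrite mulr_ge0 ?sqr_ge0.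
rewrite -ge0_integral_sum //; last by move=> j x _; rewrite lee_fin sqr_ge0.
rewrite -ge0_integralZl_EFin //; last first.
- exact/measurable_EFinP.
- by move=> x _; rewrite lee_fin sqr_ge0.
apply: ae_ge0_le_integral => //.
- by move=> x _; apply: sume_ge0 => j _; rewrite lee_fin sqr_ge0.
- exact: emeasurable_sum.
- by move=> x _; rewrite -EFinM lee_fin mulr_ge0 ?sqr_ge0.
- by apply/measurable_EFinP/measurable_funM => //; exact: measurable_cst.
apply: filterS ae_sum_operator_sqr_le => x Hx _.
rewrite sumEFin -EFinM lee_fin.
apply: le_trans (_ : mx_hsnorm (V x) ^+ 2 * \sum_j mx_hsnorm (T (e j) x) ^+ 2 <= _).
  by rewrite mulr_sumr; apply: ler_sum => j _; exact: mx_hsnorm_mulmx_sqr.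
by rewrite mulrC; apply: ler_wpM2r => //; exact: sqr_ge0.
Qed.

End OrthonormalFamily.

Lemma hs_sum_mul_le (E : set (X -> 'cV[K]_n)) : orthonormal_system m E ->
  (hs_sum m (fun f x => (V x *m T f x)%R) E <=
    (n%:R * t ^+ 2)%:E * mx_Lnorm m 2%:E V ^+ 2)%E.
Proof.
move=> [EL E1 E0]; apply: ge_ereal_sup => _ [A [finA AE] <-].
rewrite fsbig_finite //=; set r := finmap.enum_fset _.
have rE f : f \in r -> E f.
  by move=> fr; apply: AE; move: fr; rewrite in_fset_set // inE.
have r_uniq : uniq r by exact: finmap.fset_uniq.
pose e (j : 'I_(size r)) := nth (fun=> 0) r j.
have Ee j : E (e j) by apply: rE; exact: mem_nth.
rewrite (big_nth (fun=> 0)) big_mkord.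
apply: (@sum_mul_operator_sqr_le _ e) => [j|j l]; first exact: EL.
have [<-|jl] := eqVneq j l; first exact: E1.
apply: E0 => //; apply/eqP.
by rewrite /e nth_uniq.
Qed.

End Multiplication.

End HilbertSchmidt.

Theorem proposition2p6 (d : measure_display) (X : measurableType d)
    (R : realType) (m : {measure set X -> \bar R})
    (m_sigma_finite : sigma_finite [set: X] m)
    (k : scalar_kind) (n : nat) (n_ge1 : (1 <= n)%N)
    (T : (X -> 'cV[scalar_field R k]_n) -> (X -> 'cV[scalar_field R k]_n))
    (T_bounded : bounded_operator m 2%:E +oo%E T)
    (V : X -> 'M[scalar_field R k]_n)
    (V_measurable : measurable_mx V)
    (V_hermitian : forall x, is_hermitian (V x))
    (V_finite : (mx_Lnorm m 2%:E V < +oo)%E) :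
  let VT := fun f x => V x *m T f x in
  [/\ bounded_operator m 2%:E 2%:E VT,
      hilbert_schmidt m VT
    & (hs_norm m VT <=
       (Num.sqrt n%:R)%:E * mx_Lnorm m 2%:E V * operator_norm m 2%:E +oo T)%E].
Proof.
move=> VT; have VT_bounded : bounded_operator m 2%:E 2%:E VT by exact: bounded_operator_mul.
have := fineK (operator_norm_fin_num T_bounded).
have := fine_operator_norm_ge0 m T.
set t := fine _ => t0 tE.
have /fineK : mx_Lnorm m 2%:E V \is a fin_num by rewrite ge0_fin_numE ?mx_Lnorm_ge0.
have : 0 <= fine (mx_Lnorm m 2%:E V) by rewrite fine_ge0 ?mx_Lnorm_ge0.
set v := fine _ => v0 vE.
have hsle E : orthonormal_basis m E -> (hs_sum m VT E <= (n%:R * t ^+ 2 * v ^+ 2)%:E)%E.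
  move=> /orthonormal_basis_system oE; rewrite EFinM EFin_expe vE.
  exact: hs_sum_mul_le.
split => //.
  split => //; have [E oE] := orthonormal_basis_exists m k n.
  by exists E => //; apply: le_lt_trans (hsle E oE) _; exact: ltry.
rewrite -vE -tE -!EFinM.
apply: ge_ereal_sup => _ [E oE <-].
have -> : (Num.sqrt n%:R * v * t)%:E = sqrte (n%:R * t ^+ 2 * v ^+ 2)%:E.
  have -> : n%:R * t ^+ 2 * v ^+ 2 = n%:R * (v * t) ^+ 2 by ring.
  by rewrite /= sqrtrM // sqrtr_sqr ger0_norm ?mulr_ge0 // mulrA.
by rewrite lee_sqrt ?hsle // lee_fin !mulr_ge0 ?sqr_ge0.
Qed.
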